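(* Let $G$ be a finite abelian group of order $n$ and let $D=\{(g,g) \mid g\in G\}$ denote the diagonal subgroup of $G\times G$. (1) Let $P=\{(a_i,b_i) \mid i=1,\ldots,n\}$ be a subset of $G\times G$. Then $(P,D)$ is a spectral pair in $G \times G$ if and only if $\{a_i+b_i \mid i=1,\ldots,n\}=G$. (2) Let $A$ and $B$ be subsets of $G$ with $|A|\cdot|B|=|G|$. Then $A$ tiles $G$ with $B$ if and only if $(A\times B, D)$ is a spectral pair in $G\times G$.
   Context: For a finite abelian group $G$, the dual group $\hat G$ (the group of characters $G\to\mathbb{C}^\times$) is isomorphic to $G$. Fix an isomorphism $g\mapsto \chi_g$ from $G$ to $\hat G$; the characters of $G\times G$ are then indexed by elements of $G\times G$ via $\chi_{(g,h)}(a,b)=\chi_g(a)\chi_h(b)$, and in this way subsets of the dual of $G\times G$ are identified with subsets of $G\times G$. For a finite abelian group $H$ with characters $\chi_h$ indexed by $h \in H$ through such an identification (here used with $H=G\times G$), and for subsets $S, \Lambda\subset H$ with $S$ non-empty, $(S,\Lambda)$ is called a spectral pair in $H$ if the restrictions to $S$ of the characters $\chi_\lambda$, $\lambda\in\Lambda$, form an orthogonal basis of the space of complex-valued functions on $S$ (with the inner product $\langle f_1,f_2\rangle=\sum_{s\in S} f_1(s)\overline{f_2(s)}$), where the restrictions are indexed by $\lambda \in \Lambda$; in particular $|S|=|\Lambda|$. For subsets $A,B\subset G$, $A$ tiles $G$ with $B$ if every element of $G$ can be written uniquely as $a+b$ with $a\in A$ and $b\in B$. *)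

(* Defs.v *)
From HB Require Import structures.
From mathcomp Require Import all_boot all_order all_algebra.
From mathcomp Require Import reals complex.

Set Implicit Arguments.
Unset Strict Implicit.
Unset Printing Implicit Defensive.

Import Order.TTheory GRing.Theory Num.Theory.
Local Open Scope ring_scope.

HB.instance Definition _ (G1 G2 : finZmodType) :=
  GRing.Zmodule.on (G1 * G2)%type.

Definition is_character (C : numClosedFieldType) (G : finZmodType)
    (f : {ffun G -> C}) : Prop :=
  (forall x, f x != 0) /\ (forall x y, f (x + y) = f x * f y).

(* The group law of the dual group is pointwise multiplication. *)
Definition is_dual_iso (C : numClosedFieldType) (G : finZmodType)
    (chi : G -> {ffun G -> C}) : Prop :=
  [/\ forall g, is_character (chi g),
      forall g h x, chi (g + h) x = chi g x * chi h x,
      injective chi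
    & forall f, is_character f -> exists g, chi g = f].

Definition prod_char (C : numClosedFieldType) (G : finZmodType)
    (chi : G -> {ffun G -> C}) (gh : G * G) : {ffun G * G -> C} :=
  [ffun ab => chi gh.1 ab.1 * chi gh.2 ab.2].

(* Values are taken in [C^o] so that the library's vector space structure on
   finite functions applies. *)
Definition fun_on (C : numClosedFieldType) (H : finZmodType) (S : {set H}) :=
  {ffun {s : H | s \in S} -> C^o}.

Definition restr (C : numClosedFieldType) (H : finZmodType) (S : {set H})
    (f : {ffun H -> C}) : fun_on C S :=
  [ffun s => f (val s)].

Definition inner (C : numClosedFieldType) (H : finZmodType) (S : {set H})
    (f1 f2 : fun_on C S) : C :=
  \sum_s f1 s * (f2 s)^*.

(* The restrictions form a family indexed by [L]: two indices with the same
   restriction count twice and hence prevent [basis_of]. *)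
Definition spectral_pair (C : numClosedFieldType) (H : finZmodType)
    (chi : H -> {ffun H -> C}) (S L : {set H}) : Prop :=
  [/\ S != set0,
      {in L &, forall l m, l != m ->
        inner (restr S (chi l)) (restr S (chi m)) = 0}
    & basis_of fullv [seq restr S (chi l) | l <- enum L]].

Definition diagonal (G : finZmodType) : {set G * G} := [set (g, g) | g : G].

Definition tiles (G : finZmodType) (A B : {set G}) : Prop :=
  forall x : G, exists! ab : G * G,
    [/\ ab.1 \in A, ab.2 \in B & ab.1 + ab.2 = x].

(* Main.v *)
(** Restricted to the diagonal dual subgroup, the character indexed by [(g, g)]
    is [(a, b) |-> chi_g (a + b)], so everything depends only on the sum map
    [S -> G].  If the restrictions span all functions on [S], they separate the
    points of [S], hence the sum map is injective; as [#|S| = #|G|], it is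
    bijective.  Conversely, along a bijective sum map, the orthogonality of the
    characters of [G] becomes the orthogonality of the restrictions to [S]. *)

Require Import Defs.
From HB Require Import structures.
From mathcomp Require Import all_boot all_order all_algebra.
From mathcomp Require Import reals complex.

Set Implicit Arguments.
Unset Strict Implicit.
Unset Printing Implicit Defensive.

Import Order.TTheory GRing.Theory Num.Theory.
Local Open Scope ring_scope.

(** Translation by [x] permutes [G], so it leaves the sum of all elements unchanged while adding [x]
    to it [#|G|] times. *)
Lemma mulrn_card (G : finZmodType) (x : G) : x *+ #|G| = 0.
Proof.
have : \sum_(y : G) (x + y) = \sum_(y : G) y.
  by rewrite [RHS](reindex_inj (addrI x)).
by rewrite big_split sumr_const => /(canRL (addrK _)); rewrite subrr.
Qed.

Section Characters.
Variables (C : numClosedFieldType) (G : finZmodType).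
Implicit Types f g : {ffun G -> C}.

Lemma character0 f : is_character f -> f 0 = 1.
Proof.
by case=> f_neq0 fD; apply: (mulfI (f_neq0 0)); rewrite -fD addr0 mulr1.
Qed.

(** Since [x] is killed by [#|G|], the value [f x] is a root of unity. *)
Lemma character_norm f x : is_character f -> `|f x| = 1.
Proof.
move=> f_char; have [_ fD] := f_char.
have fX n : f (x *+ n) = f x ^+ n.
  elim: n => [|n IHn]; first by rewrite mulr0n expr0 character0.
  by rewrite mulrS fD IHn exprS.
have G_gt0 : (0 < #|G|)%N by apply/card_gt0P; exists x.
apply/eqP; rewrite -(pexpr_eq1 G_gt0) // -normrX -fX mulrn_card.
by rewrite character0 // normr1.
Qed.

Lemma character_mul_conj f x : is_character f -> f x * (f x)^* = 1.
Proof. by move=> f_char; rewrite -normCK character_norm // expr1n. Qed.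

(** Translating the summation variable by a point [y] where [f] and [g] differ multiplies the sum by
    [f y * (g y)^*], which is not 1. *)
Lemma character_orthogonal f g : is_character f -> is_character g ->
  f != g -> \sum_x f x * (g x)^* = 0.
Proof.
move=> f_char g_char neq_fg; set T := \sum_x _.
have [_ fD] := f_char; have [_ gD] := g_char.
have [y neq_fgy] : exists y, f y != g y.
  apply/existsP; apply: contraNT neq_fg; rewrite negb_exists => /forallP eq_fg.
  by apply/eqP/ffunP => y; apply/eqP; have := eq_fg y; rewrite negbK.
have defT : T = f y * (g y)^* * T.
  rewrite {1}/T (reindex_inj (addrI y)) mulr_sumr; apply: eq_bigr => x _.
  by rewrite fD gD rmorphM mulrACA.
(* Multiplying by [g y] cancels its conjugate, leaving [(g y - f y) * T = 0] with a nonzero first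
   factor. *)
have gT : g y * T = f y * T.
  by rewrite {1}defT mulrA mulrCA character_mul_conj // mulr1.
apply/eqP; move/eqP: gT; rewrite -subr_eq0 -mulrBl mulf_eq0 subr_eq0.
by rewrite eq_sym (negPf neq_fgy).
Qed.

End Characters.

Section FunctionsOnSubsets.
Variables (C : numClosedFieldType) (H : finZmodType) (S : {set H}).

Lemma dim_fun_on : \dim {: fun_on C S} = #|S|.
Proof. by rewrite dimvf /dim /= muln1 card_sig; apply: eq_card. Qed.

Lemma inner_suml (I : finType) (k : I -> C) (F : I -> fun_on C S) g :
  inner (\sum_i k i *: F i) g = \sum_i k i * inner (F i) g.
Proof.
under [RHS]eq_bigr do rewrite mulr_sumr.
rewrite /inner exchange_big; apply: eq_bigr => s _.
rewrite sum_ffunE mulr_suml; apply: eq_bigr => i _.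
by rewrite ffunE -mulrA.
Qed.

(** Pairing a vanishing combination with the [j]-th vector isolates the [j]-th coefficient. *)
Lemma orthogonal_free (n : nat) (X : n.-tuple (fun_on C S)) :
    (forall i : 'I_n, inner X`_i X`_i != 0) ->
    (forall i j : 'I_n, i != j -> inner X`_i X`_j = 0) ->
  free X.
Proof.
move=> X_neq0 X_orth; apply/freeP => k k0 j.
have: inner (\sum_(i < n) k i *: X`_i) X`_j = 0.
  by rewrite k0 /inner big1 // => s _; rewrite ffunE mul0r.
rewrite inner_suml (bigD1 j) //= big1 => [|i neq_ij].
  by rewrite addr0 => /eqP; rewrite mulf_eq0 (negPf (X_neq0 j)) orbF => /eqP.
by rewrite X_orth ?mulr0.
Qed.

(** Equality of values at [s] and [t] passes to linear combinations, hence to the indicator function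
    of [s], which lies in the span. *)
Lemma span_separates (X : seq (fun_on C S)) (s t : {s | s \in S}) :
  <<X>>%VS = fullv -> {in X, forall f : fun_on C S, f s = f t} -> s = t.
Proof.
move=> spanX X_st; pose d : fun_on C S := [ffun u => (u == s)%:R].
have : d \in <<X>>%VS by rewrite spanX memvf.
move=> /(@coord_span _ _ _ (in_tuple X)) def_d.
have : d s = d t.
  rewrite def_d !sum_ffunE; apply: eq_bigr => i _; rewrite !ffunE.
  by rewrite X_st // mem_nth.
by rewrite !ffunE eqxx; case: eqP => // _ /eqP; rewrite oner_eq0.
Qed.

End FunctionsOnSubsets.

Lemma card_diagonal (G : finZmodType) : #|diagonal G| = #|G|.
Proof. by rewrite card_imset // => g h []. Qed.

Lemma diagonal_spectral_pairP (C : numClosedFieldType) (G : finZmodType)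
    (chi : G -> {ffun G -> C}) (S : {set G * G}) : is_dual_iso chi ->
  spectral_pair (prod_char chi) S (diagonal G) <->
  {in S &, injective (fun ab => ab.1 + ab.2)} /\ #|S| = #|G|.
Proof.
case=> chi_char _ chi_inj _.
pose sum (s : {s | s \in S}) := (val s).1 + (val s).2.
have charE g s : restr S (prod_char chi (g, g)) s = chi g (sum s).
  by have [_ chiD] := chi_char g; rewrite !ffunE chiD.
split=> [[_ _ basisD]|[sum_inj cardS]].
  (* The cardinality comes from comparing the size of the basis with the dimension [#|S|]. *)
  split=> [s t Ss St eq_st|]; last first.
    have := @size_basis _ _ _ _ (in_tuple _) basisD.
    by rewrite dim_fun_on size_map -cardE card_diagonal.
  apply: (congr1 val (_ : Sub s Ss = Sub t St :> {s | s \in S})).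
  apply: span_separates (span_basis basisD) _ => f /mapP[l + ->].
  by rewrite mem_enum => /imsetP[g _ ->]; rewrite !charE /sum /= eq_st.
have sum_bij : bijective sum.
  apply: inj_card_bij => [s t /sum_inj eq_st|]; last first.
    by rewrite -cardS card_sig; apply/eq_leq/eq_card.
  by apply: val_inj; apply: eq_st; apply: valP.
have innerE g h :
    inner (restr S (prod_char chi (g, g))) (restr S (prod_char chi (h, h))) =
    \sum_x chi g x * (chi h x)^*.
  rewrite [RHS](reindex sum); last exact: onW_bij.
  by apply: eq_bigr => s _; rewrite !charE.
have orthD : {in diagonal G &, forall l m, l != m ->
    inner (restr S (prod_char chi l)) (restr S (prod_char chi m)) = 0}.
  move=> _ _ /imsetP[g _ ->] /imsetP[h _ ->] neq_gh.
  rewrite innerE character_orthogonal // (inj_eq chi_inj).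
  by apply: contraNneq neq_gh => ->.
have G_gt0 : (0 < #|G|)%N by apply/card_gt0P; exists 0.
split=> //; first by rewrite -card_gt0 cardS.
(* The family has as many members as the dimension, so only freeness remains. *)
rewrite basisEfree subvf dim_fun_on size_map -cardE card_diagonal cardS leqnn.
rewrite !andbT.
set D := enum _; set X := map _ _.
have sizeX : size X = size D by rewrite size_map.
have nthX i : (i < size X)%N -> X`_i = restr S (prod_char chi (nth 0 D i)).
  by rewrite sizeX => lt_i; rewrite (nth_map 0).
have memD i : (i < size X)%N -> nth 0 D i \in diagonal G.
  by rewrite sizeX -mem_enum; apply: mem_nth.
apply: (@orthogonal_free _ _ _ _ (in_tuple X)) => [i|i j neq_ij].
  rewrite nthX //; have /imsetP[g _ ->] := memD i (ltn_ord i).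
  rewrite innerE (eq_bigr (fun=> 1)) => [|x _]; last exact: character_mul_conj.
  by rewrite sumr_const pnatr_eq0 -lt0n.
(* Distinct positions carry distinct indices because [enum] has no repetition. *)
rewrite !nthX //; apply: orthD; rewrite ?memD //.
by rewrite nth_uniq -?sizeX ?enum_uniq.
Qed.

(** Uniqueness of the decomposition is injectivity of the sum map; existence then follows by
    counting, as [setX A B] has [#|G|] elements. *)
Lemma tilesP (G : finZmodType) (A B : {set G}) : (#|A| * #|B|)%N = #|G| ->
  tiles A B <-> {in setX A B &, injective (fun ab => ab.1 + ab.2)}.
Proof.
move=> cardAB; split=> [AB_tiles s t|sum_inj x].
  rewrite !inE => /andP[sA sB] /andP[tA tB] eq_st.
  have [u [_ u_uniq]] := AB_tiles (s.1 + s.2).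
  by transitivity u; [symmetry|]; apply: u_uniq.
have : x \in [set ab.1 + ab.2 | ab in setX A B].
  suff -> : [set ab.1 + ab.2 | ab in setX A B] = [set: G] by rewrite inE.
  apply/eqP; rewrite eqEcard subsetT cardsT card_in_imset //.
  by rewrite cardsX cardAB /=.
case/imsetP=> s ABs ->; have := ABs; rewrite inE => /andP[sA sB].
exists s; split=> // t [tA tB eq_ts].
by apply: sum_inj; rewrite // inE tA.
Qed.

Theorem theorem3 (R : realType) (G : finZmodType) (n : nat) (hn : #|G| = n)
    (chi : G -> {ffun G -> R[i]%C}) (hchi : is_dual_iso chi) :
  (forall a b : 'I_n -> G,
     spectral_pair (prod_char chi) [set (a i, b i) | i : 'I_n] (diagonal G) <->
     [set a i + b i | i : 'I_n] = [set: G])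
  /\
  (forall A B : {set G}, (#|A| * #|B|)%N = #|G| ->
     (tiles A B <-> spectral_pair (prod_char chi) (setX A B) (diagonal G))).
Proof.
split=> [a b|A B cardAB]; last first.
  rewrite diagonal_spectral_pairP // cardsX tilesP //.
  by split=> [|[]].
rewrite diagonal_spectral_pairP //; set P := imset _ _.
pose sum (ab : G * G) := ab.1 + ab.2.
have -> : [set a i + b i | i : 'I_n] = sum @: P.
  by rewrite -imset_comp; apply: eq_imset.
split=> [[sum_inj cardP]|sumP].
  by apply/eqP; rewrite eqEcard subsetT cardsT card_in_imset // cardP /=.
(* The pairs [(a i, b i)] may repeat a priori, which only gives [#|P| <= n]; the reverse bound holds
   because the sums cover [G]. *)
have cardP : #|P| = #|G|.
  apply/eqP; rewrite eqn_leq; apply/andP; split.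
    by rewrite (leq_trans (leq_imset_card _ _)) // card_ord hn.
  by have := leq_imset_card sum P; rewrite sumP cardsT.
by split=> //; apply/imset_injP; rewrite sumP cardsT cardP.
Qed.
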